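(* Let $X,U,V$ be Banach spaces, let $A:D(A)\subset X\to X$ generate a $C_0$-semigroup $T=(T(t))_{t\ge 0}$ on $X$, let $B\in L(U,X_{-1})$, $B_2\in L(V,X_{-1})$ and $f:X\times U\to V$. Assume: (a) $B$ is $\infty$-admissible for $T$, and the map $(t,u)\mapsto \Phi(t)u:=\int_0^tT_{-1}(t-s)Bu(s)\,ds$ is continuous from $\mathbb{R}_+\times L^\infty(\mathbb{R}_+,U)$ to $X$; (b) $B_2$ is zero-class $\infty$-admissible for $T$, and for all $u\in L^\infty(\mathbb{R}_+,U)$ and all $x\in C(\mathbb{R}_+,X)$ the map $s\mapsto f(x(s),u(s))$ is in $L^\infty_{loc}(\mathbb{R}_+,V)$; (c) for every $C>0$ there is $L(C)>0$ with $\|f(y,v)-f(x,v)\|_V\le L(C)\|y-x\|_X$ for all $x,y\in X$ with $\|x\|_X,\|y\|_X<C$ and all $v\in U$ with $\|v\|_U<C$; $f(x,\cdot)$ is continuous for every $x\in X$; and there are $\sigma\in\mathcal{K}_\infty$, $c>0$ with $\|f(0,u)\|_V\le\sigma(\|u\|_U)+c$ for all $u\in U$. Then the system $\dot x(t)=Ax(t)+B_2f(x(t),u(t))+Bu(t)$, $x(0)=x_0$, with inputs in $\mathcal{U}:=L^\infty(\mathbb{R}_+,U)$ and flow $\phi$, has the boundedness-implies-continuation property: for each $(x,u)\in X\times\mathcal{U}$ with $t_m(x,u)<\infty$ it holds that $$\limsup_{t\to t_m(x,u)-0}\|\phi(t,x,u)\|_X=\infty.$$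
   Context: $\mathcal{K}_\infty$ is the set of continuous, strictly increasing, unbounded $\gamma:\mathbb{R}_+\to\mathbb{R}_+$ with $\gamma(0)=0$. $X_{-1}$ is the completion of $X$ in the norm $x\mapsto\|(aI-A)^{-1}x\|_X$ with some $a\in\rho(A)$; $T$ extends uniquely to a $C_0$-semigroup $T_{-1}=(T_{-1}(t))_{t\ge0}$ on $X_{-1}$. $L^\infty_{loc}(\mathbb{R}_+,Y)$: strongly measurable functions $\mathbb{R}_+\to Y$ that are essentially bounded on every $[0,t]$. An operator $B\in L(U,X_{-1})$ is $\infty$-admissible for $T$ if there is $t>0$ such that $\int_0^tT_{-1}(t-s)Bu(s)\,ds\in X$ for all $u\in L^\infty_{loc}(\mathbb{R}_+,U)$. Equivalently (known fact), for every $t>0$ there is $h_t>0$ such that for all $u\in L^\infty_{loc}(\mathbb{R}_+,U)$ this integral lies in $X$ and has $X$-norm at most $h_t\|u\|_{L^\infty([0,t],U)}$; $t\mapsto h_t$ is assumed (without loss of generality) nondecreasing. $B$ is zero-class $\infty$-admissible if the constants can be chosen with $\lim_{t\to+0}h_t=0$. The same definitions apply to $B_2$ with $V$ in place of $U$. A mild solution on $[0,\tau]$ is a function $x\in C([0,\tau],X)$ such that for all $t\in[0,\tau]$ $$x(t)=T(t)x_0+\int_0^tT_{-1}(t-s)B_2f(x(s),u(s))\,ds+\int_0^tT_{-1}(t-s)Bu(s)\,ds,$$ with Bochner integrals of $X_{-1}$-valued maps. A function on $[0,t_1)$ is a mild solution if its restriction to $[0,\tau]$ is one for every $\tau\in(0,t_1)$;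 a mild solution is maximal if it cannot be extended to a mild solution (same $x_0,u$) on a larger interval. Under (a)–(c), for every $x_0\in X$, $u\in\mathcal{U}$ there is a unique maximal mild solution, denoted $\phi(\cdot,x_0,u):[0,t_m(x_0,u))\to X$, $0<t_m(x_0,u)\le\infty$; $\phi$ is called the flow. *)

(* Defs.v *)
From HB Require Import structures.
From mathcomp Require Import all_boot all_order all_algebra.
From mathcomp Require Import all_classical all_reals all_analysis ess_sup_inf.

Set Implicit Arguments.
Unset Strict Implicit.
Unset Printing Implicit Defensive.

Import Order.TTheory GRing.Theory Num.Theory.
Import numFieldNormedType.Exports.

Local Open Scope classical_set_scope.
Local Open Scope ring_scope.

(* Functions on [0, +oo[ or [0, t] are represented by total functions on R
   whose values outside of the intended domain are never used. *)

Section StrongMeasurability.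
Context {R : realType} {E : normedModType R}.
Implicit Types (D : set R) (g s : R -> E) (t : R).

Definition simple_function s :=
  finite_set (range s) /\ forall y, measurable (s @^-1` [set y]).

(* [measurable] is Borel measurability here; up to a null set every
   Lebesgue-measurable simple function is of this kind, so that the
   definitions below are the ones for Lebesgue measure. *)
Definition strongly_measurable D g := exists s : nat -> R -> E,
  (forall n, simple_function (s n)) /\
  {ae lebesgue_measure, forall r, D r -> s n r @[n --> \oo] --> g r}.

Definition simple_integral t s : E :=
  \sum_(y \in range s)
    fine (lebesgue_measure (`[0, t] `&` s @^-1` [set y])) *: y.

(* g is Bochner integrable on [0, t], with integral v *)
Definition is_bochner_integral t g (v : E) := exists s : nat -> R -> E,
  [/\ forall n, simple_function (s n),
      {ae lebesgue_measure, forall r, r \in `[0, t] -> s n r @[n --> \oo] --> g r},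
      (\int[lebesgue_measure]_(r in `[0%R, t]) (`|g r - s n r|)%:E)%E
        @[n --> \oo] --> 0%E &
      simple_integral t (s n) @[n --> \oo] --> v].

(* essential supremum of the norm over D *)
Definition Linfty_norm D g : \bar R :=
  ess_sup lebesgue_measure ((fun r => (`|g r|)%:E) \_ D).

(* L^oo(R_+, E) *)
Definition Linfty g :=
  strongly_measurable `[0, +oo[ g /\ (Linfty_norm `[0%R, +oo[ g < +oo)%E.

(* L^oo_loc(R_+, E) *)
Definition Linfty_loc g := strongly_measurable `[0, +oo[ g /\
  forall t, 0 <= t -> (Linfty_norm `[0%R, t] g < +oo)%E.

End StrongMeasurability.

Section Semigroups.
Context {R : realType}.

Definition C0_semigroup (E : normedModType R) (T : R -> E -> E) :=
  [/\ forall t, 0 <= t -> linear (T t) /\ continuous (T t),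
      forall x, T 0 x = x,
      forall t s x, 0 <= t -> 0 <= s -> T (t + s) x = T t (T s x) &
      forall x, T t x @[t --> 0^'+] --> x].

(* A is only meaningful on its domain DA *)
Definition generates (E : normedModType R) (DA : set E) (A : E -> E)
    (T : R -> E -> E) :=
  C0_semigroup T /\
  forall x y, (DA x /\ A x = y) <-> h^-1 *: (T h x - x) @[h --> 0^'+] --> y.

(* a \in rho(A), and Ra = (aI - A)^-1 *)
Definition is_resolvent (E : normedModType R) (DA : set E) (A : E -> E)
    (a : R) (Ra : E -> E) :=
  [/\ linear Ra, continuous Ra,
      forall x, DA (Ra x) /\ a *: Ra x - A (Ra x) = x &
      forall x, DA x -> Ra (a *: x - A x) = x].

(* (Xm1, j) is the completion of X in the norm x |-> |(aI - A)^-1 x|, with j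
   the canonical embedding; completions are unique up to an isometric
   isomorphism. *)
Definition is_extrapolation_space (X : normedModType R) (DA : set X)
    (A : X -> X) (Xm1 : completeNormedModType R) (j : X -> Xm1) :=
  exists (a : R) (Ra : X -> X),
    [/\ is_resolvent DA A a Ra, linear j,
        forall x, `|j x| = `|Ra x| & dense (range j)].

(* Tm1 is the extension of T to a C_0-semigroup on Xm1 (unique on [0, +oo[) *)
Definition is_extrapolated_semigroup (X Xm1 : normedModType R) (j : X -> Xm1)
    (T : R -> X -> X) (Tm1 : R -> Xm1 -> Xm1) :=
  C0_semigroup Tm1 /\ forall t x, 0 <= t -> Tm1 t (j x) = j (T t x).

End Semigroups.

Section Admissibility.
Context {R : realType} {X Xm1 W : normedModType R}.
Variables (j : X -> Xm1) (Tm1 : R -> Xm1 -> Xm1) (B : W -> Xm1).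

(* y = int_0^t Tm1 (t - s) B w(s) ds *)
Definition is_convolution (t : R) (w : R -> W) (y : Xm1) :=
  is_bochner_integral t (fun s => Tm1 (t - s) (B (w s))) y.

Definition infty_admissible := exists2 t : R, 0 < t &
  forall w, Linfty_loc w -> exists x : X, is_convolution t w (j x).

Definition zero_class_infty_admissible := exists h : R -> R,
  [/\ forall t, 0 < t -> 0 < h t,
      forall s t, 0 < s -> s <= t -> h s <= h t,
      forall t w, 0 < t -> Linfty_loc w -> exists x : X,
        is_convolution t w (j x) /\
        ((`|x|)%:E <= (h t)%:E * Linfty_norm `[0%R, t] w)%E &
      h t @[t --> 0^'+] --> 0].

(* (t, w) |-> Phi t w is a continuous map R_+ x L^oo(R_+, W) -> X *)
Definition input_map_continuous := exists Phi : R -> (R -> W) -> X,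
  (forall t w, 0 <= t -> Linfty w -> is_convolution t w (j (Phi t w))) /\
  forall t w, 0 <= t -> Linfty w -> forall e, 0 < e ->
  exists2 d : R, 0 < d & forall t' w', 0 <= t' -> Linfty w' ->
    `|t' - t| < d -> (Linfty_norm `[0%R, +oo[ (w' \- w)%R < d%:E)%E ->
    `|Phi t' w' - Phi t w| < e.

End Admissibility.

Definition Kinfty {R : realType} (g : R -> R) :=
  [/\ {within `[0, +oo[, continuous g},
      forall r s, 0 <= r -> r < s -> g r < g s,
      forall M, exists2 r, 0 <= r & M < g r &
      g 0 = 0].

(* forall x \in C(R_+, X) and u \in L^oo(R_+, U), f(x, u) \in L^oo_loc *)
Definition superposition_Linfty_loc {R : realType} {X U V : normedModType R}
    (f : X -> U -> V) :=
  forall (x : R -> X) (u : R -> U),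
    {within `[0, +oo[, continuous x} -> Linfty u ->
    Linfty_loc (fun s => f (x s) (u s)).

Definition Lipschitz_on_bounded {R : realType} {X U V : normedModType R}
    (f : X -> U -> V) :=
  forall C : R, 0 < C -> exists2 L : R, 0 < L &
    forall x y v, `|x| < C -> `|y| < C -> `|v| < C ->
      `|f y v - f x v| <= L * `|y - x|.

Section MildSolutions.
Context {R : realType} {X Xm1 U V : normedModType R}.
Variables (j : X -> Xm1) (T : R -> X -> X) (Tm1 : R -> Xm1 -> Xm1).
Variables (B : U -> Xm1) (B2 : V -> Xm1) (f : X -> U -> V).

(* mild solution on [0, tau]; X is identified with its image under j *)
Definition mild_solution (x0 : X) (u : R -> U) (tau : R) (x : R -> X) :=
  {within `[0, tau], continuous x} /\
  forall t, 0 <= t <= tau -> exists y1 y2 : Xm1,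
    [/\ is_convolution Tm1 B2 t (fun s => f (x s) (u s)) y1,
        is_convolution Tm1 B t u y2 &
        j (x t) = j (T t x0) + y1 + y2].

(* mild solution on [0, t1[, t1 possibly infinite *)
Definition mild_solution_until (x0 : X) (u : R -> U) (t1 : \bar R)
    (x : R -> X) :=
  forall tau : R, 0 < tau -> (tau%:E < t1)%E -> mild_solution x0 u tau x.

(* A larger interval is of the form [0, tau], tau >= t1, or [0, t2[, t2 > t1;
   an extension to the latter restricts to one to [0, tau], t1 <= tau < t2. *)
Definition maximal_mild_solution (x0 : X) (u : R -> U) (t1 : \bar R)
    (x : R -> X) :=
  [/\ (0 < t1)%E, mild_solution_until x0 u t1 x &
      ~ exists (tau : R) (y : R -> X),
          [/\ (t1 <= tau%:E)%E,
              forall t, 0 <= t -> (t%:E < t1)%E -> y t = x t &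
              mild_solution x0 u tau y]].

(* phi is the flow, with maximal existence times tm *)
Definition is_flow (tm : X -> (R -> U) -> \bar R)
    (phi : R -> X -> (R -> U) -> X) :=
  forall x0 u, Linfty u ->
    maximal_mild_solution x0 u (tm x0 u) (fun t => phi t x0 u).

End MildSolutions.

(* boundedness-implies-continuation property *)
Definition BIC {R : realType} {X U : normedModType R}
    (tm : X -> (R -> U) -> \bar R) (phi : R -> X -> (R -> U) -> X) :=
  forall x u, Linfty u -> (tm x u < +oo)%E ->
    limf_esup (fun t => (`|phi t x u|)%:E) (fine (tm x u))^'- = +oo%E.

(* Main.v *)
(* A trajectory x bounded near a finite time m extends to [0, m], which
   contradicts maximality. Write x(t) = T(t) x0 + Psi(t) + Phi(t) u, where Psi
   is the convolution with f(x, u). For a < t the convolution splits as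
     Psi(t) = T(t - a) Psi(a) + int_0^(t-a) T_(-1)(t-a-s) B2 f(x, u)(s+a) ds,
   and f(x, u) is essentially bounded, by M say, near m, so the last term has
   norm at most h(m - a) M, which is small for a close to m by zero-class
   admissibility. As T(.) Psi(a) is left-continuous at m - a, Psi is Cauchy at
   m-, and the same estimate with t = m shows that its limit is the convolution
   at time m of the extended trajectory. *)
Require Import Defs.
From HB Require Import structures.
From mathcomp Require Import all_boot all_order all_algebra lra.
From mathcomp Require Import all_classical all_reals all_analysis.
From mathcomp Require Import measurable_realfun ess_sup_inf.

Set Implicit Arguments.
Unset Strict Implicit.
Unset Printing Implicit Defensive.

Import Order.TTheory GRing.Theory Num.Theory.
Import numFieldNormedType.Exports.

Local Open Scope classical_set_scope.
Local Open Scope ring_scope.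

(** * Linear maps given by a predicate, and their bounds *)

Section LinearMaps.
Context {R : realType}.

(** Linearity of [T t], [j] and the resolvent is a bare predicate; the packed form makes the lemmas
    on [{linear E -> E'}] applicable to them. *)
Definition pack_linear (E E' : lmodType R) (L : E -> E') (lL : linear L) :
  {linear E -> E'} := HB.pack L (GRing.isLinear.Build _ _ _ _ _ lL).

Lemma linear_zero (E E' : lmodType R) (L : E -> E') : linear L -> L 0 = 0.
Proof. by move=> lL; exact: (linear0 (pack_linear lL)). Qed.

Lemma linear_add (E E' : lmodType R) (L : E -> E') (x y : E) :
  linear L -> L (x + y) = L x + L y.
Proof. by move=> lL; exact: (linearD (pack_linear lL)). Qed.

Lemma linear_sub (E E' : lmodType R) (L : E -> E') (x y : E) :
  linear L -> L (x - y) = L x - L y.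
Proof. by move=> lL; exact: (linearB (pack_linear lL)). Qed.

Lemma linear_continuous_bound (E E' : normedModType R) (L : E -> E') :
  linear L -> continuous L ->
  exists2 C : R, 0 < C & forall x, `|L x| <= C * `|x|.
Proof.
move=> lL cL.
pose L' := pack_linear lL.
have /linear_boundedP hb : bounded_near L' (nbhs 0).
  by apply: continuous_linear_bounded; exact: cL.
near (pinfty_nbhs R) => C; exists C; first by near: C; exact: nbhs_pinfty_gt.
by near: C.
Unshelve. all: by end_near. Qed.

End LinearMaps.

(** * Translation invariance of Lebesgue measure *)

Section LebesgueTranslation.
Context {R : realType}.
Notation mu := (@lebesgue_measure R).

Lemma measurable_shift (a : R) :
  measurable_fun [set: measurableTypeR R]
    (+%R^~ a : measurableTypeR R -> measurableTypeR R).
Proof.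
have : measurable_fun setT (+%R^~ a : R -> R) by apply: measurable_funD.
exact.
Qed.

(** The pushforward agrees with Lebesgue measure on the intervals []x1, x2]], and these determine
    the measure. *)
Lemma lebesgue_measure_shift (a : R) (D : set R) : measurable D ->
  pushforward mu (+%R^~ a : measurableTypeR R -> measurableTypeR R) D = mu D.
Proof.
move=> mD; apply/esym/lebesgue_measure_unique => //=.
  exact: measurable_shift.
move=> mf _ [[x1 x2] x12 <-]; rewrite /pushforward /=.
rewrite (_ : _ @^-1` _ = `]x1 - a, x2 - a]%classic); last first.
  apply/seteqP; split => r /=; rewrite !in_itv /= ltrBlDr lerBrDr //.
rewrite !lebesgue_measure_itv /= !lte_fin ltrD2r.
by case: ifP => // _; rewrite -!EFinB opprB addrA subrK.
Qed.

End LebesgueTranslation.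

(** * Integrals of vector-valued simple functions *)

Section SimpleFunctions.
Context {R : realType}.
Notation mu := (@lebesgue_measure R).

Lemma measure_setI_fin_num (D A : set R) : measurable D -> (mu D < +oo)%E ->
  measurable A -> mu (D `&` A) \is a fin_num.
Proof.
move=> mD Dfin mA; rewrite ge0_fin_numE//; apply: le_lt_trans Dfin.
by apply: le_measure; rewrite ?inE//; apply: measurableI.
Qed.

(** The range is finite, so the preimage of any set is a finite union of level sets. *)
Lemma simple_preimage_measurable (E : normedModType R) (s : R -> E)
  (Y : set E) : simple_function s -> measurable (s @^-1` Y).
Proof.
move=> [fs ms].
rewrite (_ : s @^-1` Y = \bigcup_(y in range s `&` Y) s @^-1` [set y]).
  by apply: fin_bigcup_measurable => //; exact: finite_setIl.
apply/seteqP; split => [r Yr|r [y [_ Yy]] /= ->//].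
by exists (s r) => //; split => //; exists r.
Qed.

Lemma simple_comp (E E' : normedModType R) (h : E -> E') (s : R -> E) :
  simple_function s -> simple_function (h \o s).
Proof.
move=> hs; have [fs _] := hs.
split; last by move=> y; exact: (simple_preimage_measurable (h @^-1` [set y])).
by have := finite_image h fs; rewrite image_comp.
Qed.

Lemma simple_pair (E E' : normedModType R) (s : R -> E) (s' : R -> E') :
  simple_function s -> simple_function s' ->
  simple_function (fun r => (s r, s' r)).
Proof.
move=> [fs ms] [fs' ms']; split.
  apply: (@sub_finite_set _ _ (range s `*` range s')); last exact: finite_setX.
  by move=> _ [r _ <-]; split; exists r.
move=> [y y']; rewrite (_ : _ @^-1` _ = s @^-1` [set y] `&` s' @^-1` [set y']).
  by apply: measurableI.
by apply/seteqP; split => r /= [-> ->].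
Qed.

Lemma simple_shift (E : normedModType R) (s : R -> E) (a : R) :
  simple_function s -> simple_function (s \o +%R^~ a).
Proof.
move=> [fs ms]; split.
  by apply: sub_finite_set fs => _ [r _ <-]; exists (r + a).
move=> y; rewrite comp_preimage -[X in measurable X]setTI.
by apply: (measurable_shift a) => //; exact: ms.
Qed.

(** This is [simple_integral] over a general set, so that the domain can be split, translated and
    freed of null sets. *)
Definition sintegral_on (E : normedModType R) (D : set R) (s : R -> E) : E :=
  \sum_(y \in range s) fine (mu (D `&` s @^-1` [set y])) *: y.

(** The sum is regrouped over the level sets of [s], which refine those of [h \o s]. Applied to a
    pair of simple functions it yields a partition common to both. *)
Lemma sintegral_on_comp (E E' : normedModType R) (D : set R) (h : E -> E')
    (s : R -> E) :
  measurable D -> (mu D < +oo)%E -> simple_function s ->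
  sintegral_on D (h \o s) =
    \sum_(z \in range s) fine (mu (D `&` s @^-1` [set z])) *: h z.
Proof.
move=> mD Dfin ss; have [fs ms] := ss.
have fhs : finite_set (range (h \o s)) by have [] := simple_comp h ss.
have mfin z : (mu (D `&` s @^-1` [set z]) \is a fin_num).
  exact: measure_setI_fin_num.
pose m z := fine (mu (D `&` s @^-1` [set z])).
have key y : fine (mu (D `&` (h \o s) @^-1` [set y])) =
    \sum_(z \in range s) (if h z == y then m z else 0).
  (* Level sets with the wrong value are replaced by the empty set, so that the disjoint union runs
     over the whole range of [s]. *)
  pose F z := if h z == y then D `&` s @^-1` [set z] else set0.
  have -> : D `&` (h \o s) @^-1` [set y] = \big[setU/set0]_(z \in range s) F z.
    rewrite fsbig_setU//; apply/seteqP; split => r.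
      move=> [Dr /= hy]; exists (s r); first by exists r.
      by rewrite /F hy eqxx.
    by move=> [z _]; rewrite /F; case: eqP => // <- [Dr /= ->].
  rewrite measure_fsbig//; last 2 first.
  - move=> z _; rewrite /F; case: ifP => [_|_]; last exact: measurable0.
    by apply: measurableI => //; exact: ms.
  - move=> z z' _ _ [r []]; rewrite /F; case: ifP => [_ [_ /= <-]|_ []].
    by case: ifP => [_ [_ /= <-]|_ []].
  rewrite !fsbig_finite//= -sum_fine; last first.
    by move=> z _; rewrite /F; case: ifP => _; rewrite ?measure0 ?mfin.
  by apply: eq_bigr => z _; rewrite /F; case: ifP => //; rewrite measure0.
rewrite /sintegral_on.
transitivity (\sum_(y \in range (h \o s)) \sum_(z \in range s)
    ((if h z == y then m z else 0) *: y)).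
  by apply: eq_fsbigr => y _; rewrite key !fsbig_finite// scaler_suml.
rewrite exchange_fsbig//; apply: eq_fsbigr => z /set_mem [r _ <-].
rewrite (@fsbigD1 _ _ _ _ (h (s r)))//=; last by exists r.
rewrite eqxx fsbig1 ?addr0// => y [_ /= /eqP].
by rewrite eq_sym => /negbTE ->; rewrite scale0r.
Qed.

Lemma sintegral_onB (E : normedModType R) (D : set R) (s s' : R -> E) :
  measurable D -> (mu D < +oo)%E -> simple_function s -> simple_function s' ->
  sintegral_on D (fun r => s r - s' r) = sintegral_on D s - sintegral_on D s'.
Proof.
move=> mD Dfin ss ss'; have ssp := simple_pair ss ss'.
have [fp _] := ssp.
(* All three integrals become sums over the range of the pair, where the identity holds term by
   term. *)
rewrite (sintegral_on_comp (fun z : E * E => z.1 - z.2) mD Dfin ssp).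
rewrite (sintegral_on_comp (fun z : E * E => z.1) mD Dfin ssp).
rewrite (sintegral_on_comp (fun z : E * E => z.2) mD Dfin ssp).
rewrite !fsbig_finite// -sumrB.
by apply: eq_bigr => z _; rewrite scalerBr.
Qed.

Lemma sintegral_on_linear (E E' : normedModType R) (D : set R) (L : E -> E')
    (s : R -> E) :
  measurable D -> (mu D < +oo)%E -> linear L -> simple_function s ->
  sintegral_on D (L \o s) = L (sintegral_on D s).
Proof.
move=> mD Dfin lL ss; have [fs _] := ss.
rewrite sintegral_on_comp// /sintegral_on.
pose L' := pack_linear lL.
rewrite !fsbig_finite//; rewrite -[L]/(L' : _ -> _) linear_sum.
by apply: eq_bigr => z _; rewrite linearZ.
Qed.

Lemma sintegral_on_setU (E : normedModType R) (D D' : set R) (s : R -> E) :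
  measurable D -> (mu D < +oo)%E -> measurable D' -> (mu D' < +oo)%E ->
  D `&` D' = set0 -> simple_function s ->
  sintegral_on (D `|` D') s = sintegral_on D s + sintegral_on D' s.
Proof.
move=> mD Dfin mD' Dfin' DD' [fs ms].
rewrite /sintegral_on !fsbig_finite// -big_split/=.
apply: eq_bigr => y _; rewrite -scalerDl setIUl.
have fin A : measurable A -> (mu A < +oo)%E ->
    mu (A `&` s @^-1` [set y]) \is a fin_num.
  by move=> mA Afin; exact: measure_setI_fin_num.
rewrite measureU ?fineD ?fin//; last by rewrite setIACA DD' set0I.
- by apply: measurableI => //; exact: ms.
- by apply: measurableI => //; exact: ms.
Qed.

Lemma sintegral_on_shift (E : normedModType R) (D : set R) (s : R -> E) (a : R) :
  measurable D -> simple_function s ->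
  sintegral_on (+%R^~ a @^-1` D) (s \o +%R^~ a) = sintegral_on D s.
Proof.
move=> mD [fs ms]; rewrite /sintegral_on.
rewrite (_ : range (s \o +%R^~ a) = range s); last first.
  apply/seteqP; split => _ [r _ <-]; first by exists (r + a).
  by exists (r - a) => //=; rewrite subrK.
apply: eq_fsbigr => y _; congr (fine _ *: _).
rewrite comp_preimage -preimage_setI.
rewrite -[LHS]/(pushforward mu
  (+%R^~ a : measurableTypeR R -> measurableTypeR R) _).
by rewrite lebesgue_measure_shift//; apply: measurableI.
Qed.

Lemma measurable_simple_norm (E : normedModType R) (D : set R) (s : R -> E) :
  simple_function s -> measurable_fun D (fun r => (`|s r|)%:E).
Proof.
move=> ss; apply: measurable_funTS => _ Y mY; rewrite setTI.
exact: (simple_preimage_measurable ((fun y => (`|y|)%:E) @^-1` Y)).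
Qed.

Lemma norm_sintegral_on_le (E : normedModType R) (D : set R) (s : R -> E) :
  measurable D -> (mu D < +oo)%E -> simple_function s ->
  ((`|sintegral_on D s|)%:E <= \int[mu]_(r in D) (`|s r|)%:E)%E.
Proof.
move=> mD Dfin ss; have [fs ms] := ss.
have fin y : mu (D `&` s @^-1` [set y]) \is a fin_num.
  exact: measure_setI_fin_num.
apply: (@le_trans _ _ (\sum_(y \in range s)
    (fine (mu (D `&` s @^-1` [set y])) * `|y|)%:E)%E).
  rewrite fsumEFin// lee_fin /sintegral_on !fsbig_finite//.
  apply: le_trans (ler_norm_sum _ _ _) _; apply: ler_sum => y _.
  by rewrite normrZ ger0_norm ?fine_ge0.
rewrite le_eqVlt; apply/orP; left; apply/eqP.
(* The norm of [s] is a finite combination of indicators of level sets, of which only the one at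
   [s r] is nonzero at [r]. *)
transitivity (\int[mu]_(r in D) (\sum_(y \in range s)
    (`|y| * \1_(s @^-1` [set y]) r)%:E))%E; last first.
  apply: eq_integral => r _.
  rewrite (@fsbigD1 _ _ _ _ (s r))//=; last by exists r.
  rewrite indicE mem_set//= mulr1 fsbig1 ?adde0// => y [_ /= yr].
  by rewrite indicE memNset ?mulr0//= => /esym.
rewrite ge0_integral_fsum//; last first.
  move=> y; apply/measurable_EFinP/measurable_funM => //.
  by apply: measurable_indic; exact: ms.
apply: eq_fsbigr => y _.
under eq_integral do rewrite EFinM.
rewrite ge0_integralZl//; last first.
  by apply/measurable_EFinP; apply: measurable_indic; exact: ms.
rewrite integral_indic//; last exact: ms.
by rewrite mulrC EFinM fineK; [rewrite setIC|exact: fin].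
Qed.

End SimpleFunctions.

(** * The Bochner integral on sets, and the convolutions *)

Section BochnerIntegral.
Context {R : realType}.
Notation mu := (@lebesgue_measure R).

(* [g] need not be measurable. On [D], which is [0, t] minus a null set, the
   convergence holds everywhere, so that [`|g - s n|] is measurable on [D]. *)
Definition bochner_approx (E : normedModType R) (D : set R) (g : R -> E)
    (s : nat -> R -> E) :=
  [/\ measurable D, (mu D < +oo)%E, forall n, simple_function (s n),
      forall r, D r -> s n r @[n --> \oo] --> g r &
      (\int[mu]_(r in D) (`|g r - s n r|)%:E)%E @[n --> \oo] --> 0%E].

(** A working form of [is_bochner_integral], reached through [bochner_of_def]. *)
Definition bochner_on (E : normedModType R) (D : set R) (g : R -> E) (v : E) :=
  exists2 s : nat -> R -> E, bochner_approx D g s &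
    sintegral_on D (s n) @[n --> \oo] --> v.

(* No measurability of [f] is needed: the integral of a nonnegative function is
   a supremum over the simple functions below it. *)
Lemma ge0_integral_subset (D D' : set R) (f : R -> \bar R) : D' `<=` D ->
  (forall r, 0 <= f r)%E ->
  (\int[mu]_(r in D') f r <= \int[mu]_(r in D) f r)%E.
Proof.
move=> DD f0; rewrite !ge0_integralE//; apply: ereal_sup_le => _ [h hf <-].
exists h => // r; apply: le_trans (hf r) _.
rewrite /patch; case: ifPn => [/set_mem /DD/mem_set ->//|_].
by case: ifP.
Qed.

Lemma simpleB (E : normedModType R) (s s' : R -> E) :
  simple_function s -> simple_function s' ->
  simple_function (fun r => s r - s' r).
Proof.
move=> ss ss'.
exact: (simple_comp (fun z : E * E => z.1 - z.2) (simple_pair ss ss')).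
Qed.

(** On [D] the function is the pointwise limit of the norms of the simple functions [s k - s']. *)
Lemma measurable_approx (E : normedModType R) (D : set R) (g : R -> E)
    (s : nat -> R -> E) (s' : R -> E) :
  bochner_approx D g s -> simple_function s' ->
  measurable_fun D (fun r => (`|g r - s' r|)%:E).
Proof.
move=> [mD _ ss sg _] ss'.
apply: (emeasurable_fun_cvg (fun k r => (`|s k r - s' r|)%:E)).
  by move=> k; apply: measurable_simple_norm; exact: simpleB.
move=> r Dr; apply: cvg_EFin; first by near=> k.
by apply: cvg_norm; apply: cvgB; [exact: sg|exact: cvg_cst].
Unshelve. all: by end_near. Qed.

(** The difference is at most the integral of [|s n - s' n|], hence at most the sum of the two
    approximation errors. Thus the integral depends on [g] alone, whichever sequence is used. *)
Lemma approx_sintegral_onB (E : normedModType R) (D : set R) (g : R -> E)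
    (s s' : nat -> R -> E) : bochner_approx D g s -> bochner_approx D g s' ->
  sintegral_on D (s n) - sintegral_on D (s' n) @[n --> \oo] --> (0 : E).
Proof.
move=> as1 as2; have [mD Dfin ss sg i1] := as1; have [_ _ ss' sg' i2] := as2.
apply: norm_cvg0.
suff /fine_cvgP[_ //] : (`|sintegral_on D (s n) - sintegral_on D (s' n)|)%:E
    @[n --> \oo] --> 0%E.
have h n : (0 <= (`|sintegral_on D (s n) - sintegral_on D (s' n)|)%:E <=
  \int[mu]_(r in D) (`|g r - s n r|)%:E +
  \int[mu]_(r in D) (`|g r - s' n r|)%:E)%E.
  rewrite lee_fin normr_ge0/= -sintegral_onB//.
  apply: le_trans (norm_sintegral_on_le _ _ _) _ => //; first exact: simpleB.
  rewrite -ge0_integralD//; last 2 first.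
  - exact: (measurable_approx as1).
  - exact: (measurable_approx as2).
  apply: ge0_le_integral => //.
  - by apply: measurable_simple_norm; exact: simpleB.
  - apply: emeasurable_funD; first exact: (measurable_approx as1).
    exact: (measurable_approx as2).
  move=> r Dr; rewrite -EFinD lee_fin.
  rewrite (_ : s n r - s' n r = (g r - s' n r) - (g r - s n r)).
    by rewrite [leRHS]addrC; exact: ler_normB.
  by rewrite opprB [RHS]addrC addrA subrK.
have i12 : (\int[mu]_(r in D) (`|g r - s n r|)%:E +
    \int[mu]_(r in D) (`|g r - s' n r|)%:E)%E @[n --> \oo] --> 0%E.
  by rewrite -[X in _ --> X]adde0; exact: cvgeD.
by apply: (squeeze_cvge _ (cvg_cst 0%E) i12); near=> n; exact: h.
Unshelve. all: by end_near. Qed.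

Lemma bochner_unique (E : normedModType R) (D : set R) (g : R -> E) (v v' : E) :
  bochner_on D g v -> bochner_on D g v' -> v = v'.
Proof.
move=> [s as1 sv] [s' as2 sv'].
apply/eqP; rewrite -subr_eq0; apply/eqP.
apply: (norm_cvg_unique _ (approx_sintegral_onB as1 as2)); exact: cvgB.
Qed.

Lemma eq_bochner (E : normedModType R) (D : set R) (g g' : R -> E) (v : E) :
  (forall r, D r -> g r = g' r) -> bochner_on D g v -> bochner_on D g' v.
Proof.
move=> gg' [s [mD Dfin ss sg i] sv]; exists s => //; split => //.
  by move=> r Dr; rewrite -gg'//; exact: sg.
apply: cvg_trans i; apply: near_eq_cvg; near=> n.
by apply: eq_integral => r /set_mem Dr; rewrite gg'.
Unshelve. all: by end_near. Qed.

Lemma approx_subset (E : normedModType R) (D D' : set R) (g : R -> E)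
    (s : nat -> R -> E) :
  measurable D' -> D' `<=` D -> bochner_approx D g s -> bochner_approx D' g s.
Proof.
move=> mD' DD [mD Dfin ss sg i]; split => //.
- by apply: le_lt_trans Dfin; apply: le_measure => //; rewrite inE.
- by move=> r /DD; exact: sg.
apply: (squeeze_cvge _ (cvg_cst 0%E) i); near=> n.
by rewrite integral_ge0//= ge0_integral_subset.
Unshelve. all: by end_near. Qed.

(** The three integrals come with unrelated sequences. The one for the union is restricted to each
    piece and compared there with the sequence of that piece by [approx_sintegral_onB]. *)
Lemma bochner_setU (E : normedModType R) (D D' : set R) (g : R -> E)
    (v v1 v2 : E) : D `&` D' = set0 ->
  bochner_on (D `|` D') g v -> bochner_on D g v1 -> bochner_on D' g v2 ->
  v = v1 + v2.
Proof.
move=> DD [s as0 sv] [s1 as1 sv1] [s2 as2 sv2].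
have [mD Dfin _ _ _] := as1; have [mD' Dfin' _ _ _] := as2.
have [_ _ ss _ _] := as0.
have as01 := approx_subset mD (@subsetUl _ D D') as0.
have as02 := approx_subset mD' (@subsetUr _ D D') as0.
apply: (norm_cvg_unique sv).
rewrite /= (_ : (fun n => _) = (fun n =>
    (sintegral_on D (s n) - sintegral_on D (s1 n) + sintegral_on D (s1 n)) +
    (sintegral_on D' (s n) - sintegral_on D' (s2 n)
      + sintegral_on D' (s2 n)))); last first.
  by apply/funext => n; rewrite !subrK sintegral_on_setU.
rewrite -(add0r v1) -(add0r v2); apply: cvgD.
  by apply: cvgD => //; exact: approx_sintegral_onB as01 as1.
by apply: cvgD => //; exact: approx_sintegral_onB as02 as2.
Qed.

(** The functions [L \o s n] approximate [L \o g], with errors enlarged at most by a bound [C] of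
    [L]. *)
Lemma bochner_linear (E E' : normedModType R) (D : set R) (L : E -> E')
    (g : R -> E) (v : E) : linear L -> continuous L ->
  bochner_on D g v -> bochner_on D (L \o g) (L v).
Proof.
move=> lL cL [s as1 sv]; have [mD Dfin ss sg i] := as1.
have [C C0 LC] := linear_continuous_bound lL cL.
pose L' := pack_linear lL.
exists (fun n => L \o s n); last first.
  rewrite (_ : (fun n => _) = L \o (fun n => sintegral_on D (s n))); last first.
    by apply/funext => n; rewrite sintegral_on_linear.
  exact: (cvg_comp _ _ sv (cL v)).
have ss' n : simple_function (L \o s n) by exact: simple_comp.
have Lg r : D r -> (L \o s n) r @[n --> \oo] --> (L \o g) r.
  by move=> Dr; exact: (cvg_comp _ _ (sg _ Dr) (cL (g r))).
split => //.
have iC : (C%:E * \int[mu]_(r in D) (`|g r - s n r|)%:E)%E @[n --> \oo] --> 0%E.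
  by rewrite -(mule0 C%:E); exact: cvgeZl.
apply: (squeeze_cvge _ (cvg_cst 0%E) iC); near=> n.
rewrite integral_ge0//= -ge0_integralZl//; last first.
  by rewrite lee_fin ltW.
  by apply: (measurable_approx as1).
apply: ge0_le_integral => //.
- apply: (emeasurable_fun_cvg (fun k r => (`|L (s k r) - L (s n r)|)%:E)).
    by move=> k; apply: measurable_simple_norm; exact: (simpleB (ss' k) (ss' n)).
  move=> r Dr; apply: cvg_EFin; first by near=> k.
  by apply: cvg_norm; apply: cvgB; [exact: Lg|exact: cvg_cst].
- by apply: measurable_funeM; exact: (measurable_approx as1).
move=> r Dr; rewrite -EFinM lee_fin /= -[L]/(L' : _ -> _) -linearB.
exact: LC.
Unshelve. all: by end_near. Qed.

Lemma bochner_shift (E : normedModType R) (D : set R) (g : R -> E) (v : E)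
    (a : R) : bochner_on D g v -> bochner_on (+%R^~ a @^-1` D) (g \o +%R^~ a) v.
Proof.
move=> [s as1 sv]; have [mD Dfin ss sg i] := as1.
have mDa : measurable (+%R^~ a @^-1` D).
  rewrite -[X in measurable X]setTI.
  by apply: (measurable_shift a) => //.
exists (fun n => s n \o +%R^~ a); last first.
  rewrite (_ : (fun n => _) = (fun n => sintegral_on D (s n)))//.
  by apply/funext => n; rewrite sintegral_on_shift.
split => //.
- by have := lebesgue_measure_shift a mD; rewrite /pushforward => ->.
- by move=> n; exact: simple_shift.
- by move=> r Dr; exact: sg.
apply: cvg_trans i; apply: near_eq_cvg; near=> n => /=.
(* The integral over the translated set is one over [D] against the pushforward measure, which is
   Lebesgue measure again. *)
rewrite -(@ge0_integral_pushforward _ _ _ _ _ _ (measurable_shift a) mu D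
  (fun r => (`|g r - s n r|)%:E)) //.
  apply: eq_measure_integral; first exact: (measurable_shift a).
  by move=> mf A mA AD; rewrite -[LHS](lebesgue_measure_shift a).
exact: (measurable_approx as1).
Unshelve. all: by end_near. Qed.

Lemma sintegral_on_setD_null (E : normedModType R) (D N : set R) (s : R -> E) :
  measurable D -> (mu D < +oo)%E -> measurable N -> mu N = 0%E ->
  simple_function s -> sintegral_on (D `\` N) s = sintegral_on D s.
Proof.
move=> mD Dfin mN N0 [fs ms]; apply: eq_fsbigr => y _; congr (fine _ *: _).
have mDy : measurable (D `&` s @^-1` [set y]).
  by apply: measurableI => //; exact: ms.
rewrite [in RHS](measureDI mu mDy mN).
rewrite (_ : (D `\` N) `&` _ = D `&` s @^-1` [set y] `\` N).
  rewrite (@subset_measure0 _ _ _ mu (D `&` s @^-1` [set y] `&` N) N) ?adde0//.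
  by apply: measurableI.
by apply/seteqP; split => r /= [[]].
Qed.

(** The null set may be enlarged at will, so that several integrals can be given one common
    exceptional set. *)
Lemma bochner_of_def (E : normedModType R) (t : R) (g : R -> E) (v : E) :
  is_bochner_integral t g v ->
  exists N : set R, [/\ measurable N, mu N = 0%E &
    forall N', measurable N' -> mu N' = 0%E -> N `<=` N' ->
      bochner_on (`[0, t] `\` N') g v].
Proof.
move=> [s [ss [N [mN N0 hN]] i sv]]; exists N; split => //.
move=> N' mN' N'0 NN'.
have mD : measurable (`[0, t]%classic : set R) by [].
have Dfin : (mu `[0%R, t]%classic < +oo)%E.
  by rewrite lebesgue_measure_itv/=; case: ifP => // _; rewrite ltry.
exists s; last first.
  rewrite (_ : (fun n => _) = (fun n => simple_integral t (s n)))//.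
  by apply/funext => n; rewrite sintegral_on_setD_null.
split => //.
- exact: measurableD.
- apply: le_lt_trans Dfin; apply: le_measure; rewrite ?inE//; exact: measurableD.
- move=> r [Dr nN']; have [//|nP] := pselect
    (r \in `[0, t] -> s n r @[n --> \oo] --> g r).
    exact.
  by exfalso; apply: nN'; apply: NN'; apply: hN.
apply: (squeeze_cvge _ (cvg_cst 0%E) i); near=> n.
rewrite integral_ge0//=; exact: ge0_integral_subset.
Unshelve. all: by end_near. Qed.

(** On [[0, a]] one has [Tm1 (t - r) = Tm1 (t - a) \o Tm1 (a - r)], and the bounded operator
    [Tm1 (t - a)] leaves the integral; on [[a, t]] the variable is translated by [a]. *)
Lemma convolution_split (E W : normedModType R) (Tm1 : R -> E -> E)
    (B : W -> E) (w : R -> W) (a t : R) (y1 y2 y : E) :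
  C0_semigroup Tm1 -> 0 <= a -> a <= t ->
  is_convolution Tm1 B a w y1 ->
  is_convolution Tm1 B (t - a) (fun r => w (r + a)) y2 ->
  is_convolution Tm1 B t w y ->
  y = Tm1 (t - a) y1 + y2.
Proof.
move=> [lc _ TD _] a0 at0.
move=> /bochner_of_def[N1 [mN1 N10 h1]] /bochner_of_def[N2 [mN2 N20 h2]].
move=> /bochner_of_def[N3 [mN3 N30 h3]].
have mM2 : measurable (+%R^~ (- a) @^-1` N2).
  by rewrite -[X in measurable X]setTI; apply: (measurable_shift (- a)).
have M20 : mu (+%R^~ (- a) @^-1` N2) = 0%E.
  by have := lebesgue_measure_shift (- a) mN2; rewrite /pushforward N20.
(* The set [N2] is moved from [[0, t - a]] to [[a, t]]. The point [a] is added to make the two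
   pieces of [[0, t]] disjoint. *)
pose N := N1 `|` N3 `|` (+%R^~ (- a) @^-1` N2) `|` [set a].
have mN : measurable N by do 3 (apply: measurableU => //).
have N0 : mu N = 0%E.
  rewrite /N measureU0//; [|by do 2 (apply: measurableU => //)|].
    by rewrite !measureU0//; apply: measurableU.
  exact: lebesgue_measure_set1.
have mNa : measurable (+%R^~ a @^-1` N).
  by rewrite -[X in measurable X]setTI; apply: (measurable_shift a).
have Na0 : mu (+%R^~ a @^-1` N) = 0%E.
  by have := lebesgue_measure_shift a mN; rewrite /pushforward N0.
have {}h1 : bochner_on (`[0, a] `\` N) (fun r => Tm1 (a - r) (B (w r))) y1.
  by apply: h1 => // r N1r; do 3 left.
have {}h3 : bochner_on (`[0, t] `\` N) (fun r => Tm1 (t - r) (B (w r))) y.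
  by apply: h3 => // r N3r; do 2 left; right.
have {}h2 := h2 (+%R^~ a @^-1` N) mNa Na0.
have {}h2 : bochner_on (`[0, t - a] `\` (+%R^~ a @^-1` N))
    (fun r => Tm1 (t - a - r) (B (w (r + a)))) y2.
  by apply: h2 => r N2r; left; right => /=; rewrite addrK.
have {}h2 := bochner_shift (- a) h2.
have ta0 : 0 <= t - a by rewrite subr_ge0.
have [lT cT] := lc _ ta0.
have {}h1 := bochner_linear lT cT h1.
have DD : `[0, t] `\` N = (`[0, a] `\` N) `|`
    (+%R^~ (- a) @^-1` (`[0, t - a] `\` (+%R^~ a @^-1` N))).
  apply/seteqP; split => r /=; rewrite !in_itv/= ?subrK ?subr_ge0 ?lerD2r.
    move=> [/andP[r0 rt] nN]; have [ra|ar] := lerP r a; [left|move/ltW in ar; right].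
      by rewrite r0.
    by split => //; apply/andP.
  move=> [] [/andP[h h'] nN]; split => //; apply/andP; split => //.
    exact: le_trans at0.
  exact: le_trans h.
rewrite DD in h3; apply: (bochner_setU _ h3).
- rewrite -subset0 => r /= [[]]; rewrite !in_itv/= ?subrK ?subr_ge0 ?lerD2r.
  move=> /andP[_ ra] nN [/andP[ar _] _]; apply: nN; right.
  by apply/eqP; rewrite eq_le ra ar.
- apply: eq_bochner h1 => r [/=]; rewrite in_itv/= => /andP[r0 ra] _.
  by rewrite -TD ?subr_ge0// addrA subrK.
apply: eq_bochner h2 => r [/=]; rewrite !in_itv/= => /andP[_ _] _.
by rewrite subrK opprB addrA subrK.
Qed.

(** Both integrals are taken off a common null set containing the endpoint [t]; there the integrands
    coincide. *)
Lemma convolution_unique (E W : normedModType R) (Tm1 : R -> E -> E)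
    (B : W -> E) (w w' : R -> W) (t : R) (y y' : E) :
  (forall s, 0 <= s < t -> w s = w' s) ->
  is_convolution Tm1 B t w y -> is_convolution Tm1 B t w' y' -> y = y'.
Proof.
move=> ww' /bochner_of_def[N1 [mN1 N10 h1]] /bochner_of_def[N2 [mN2 N20 h2]].
pose N := N1 `|` N2 `|` [set t].
have mN : measurable N by do 2 (apply: measurableU => //).
have N0 : mu N = 0%E.
  rewrite /N measureU0//; [|by apply: measurableU|exact: lebesgue_measure_set1].
  by rewrite !measureU0.
have {}h1 : bochner_on (`[0, t] `\` N) (fun r => Tm1 (t - r) (B (w r))) y.
  by apply: h1 => // r N1r; do 2 left.
have {}h2 : bochner_on (`[0, t] `\` N) (fun r => Tm1 (t - r) (B (w' r))) y'.
  by apply: h2 => // r N2r; left; right.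
apply: (bochner_unique _ h2); apply: eq_bochner h1 => r [/=].
rewrite in_itv/= => /andP[r0 rt] nN; rewrite ww'// r0 lt_neqAle rt andbT.
by apply/eqP => rt'; apply: nN; right.
Qed.

Lemma eq_convolution (E W : normedModType R) (Tm1 : R -> E -> E)
    (B : W -> E) (w w' : R -> W) (t : R) (y : E) :
  (forall s, 0 <= s <= t -> w s = w' s) ->
  is_convolution Tm1 B t w y -> is_convolution Tm1 B t w' y.
Proof.
move=> ww' [s [ss sg i sv]]; exists s; split => //.
  apply: negligibleS sg => r /= nP sgr; apply: nP => rt.
  rewrite -ww'; first exact: sgr.
  by move: rt; rewrite in_itv.
apply: cvg_trans i; apply: near_eq_cvg; near=> n.
by apply: eq_integral => r; rewrite inE/= in_itv/= => rt; rewrite ww'.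
Unshelve. all: by end_near. Qed.

End BochnerIntegral.

(** * Essential bounds and translation *)

Section EssentialBounds.
Context {R : realType}.
Notation mu := (@lebesgue_measure R).

Lemma negligible_shift (a : R) (A : set R) :
  mu.-negligible A -> mu.-negligible (+%R^~ a @^-1` A).
Proof.
move=> [N [mN N0 AN]]; exists (+%R^~ a @^-1` N).
split; last exact: preimage_subset.
  by rewrite -[X in measurable X]setTI; apply: (measurable_shift a).
by have := lebesgue_measure_shift a mN; rewrite /pushforward N0.
Qed.

(** [Linfty_norm] extends the norm by 0 outside [D]; [0 <= M] covers those points. *)
Lemma Linfty_norm_le (E : normedModType R) (D : set R) (g : R -> E) (M : R) :
  0 <= M -> {ae mu, forall r, D r -> `|g r| <= M} ->
  (Linfty_norm D g <= M%:E)%E.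
Proof.
move=> M0 hM; apply/ess_supP; apply: negligibleS hM => r /= nP h; apply: nP.
by rewrite /patch; case: ifPn => [/set_mem /h|]; rewrite lee_fin.
Qed.

Lemma Linfty_norm_bound (E : normedModType R) (D : set R) (g : R -> E) :
  (Linfty_norm D g < +oo)%E -> exists2 M : R, 0 <= M &
    {ae mu, forall r, D r -> `|g r| <= M}.
Proof.
rewrite /Linfty_norm; set f := (X in ess_sup _ X) => fin.
have [M M0 fM] : exists2 M : R, 0 <= M & (ess_sup mu f <= M%:E)%E.
  case: (ess_sup mu f) fin => [r| |]// _.
    by exists `|r| => //; rewrite lee_fin ler_norm.
  by exists 0 => //; rewrite leNye.
exists M => //; move/ess_supP : fM.
apply: negligibleS => r /= nP h; apply: nP => Dr.
by move: h; rewrite /f /patch mem_set// lee_fin.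
Qed.

Lemma Linfty_loc_shift (E : normedModType R) (g : R -> E) (a : R) :
  0 <= a -> Linfty_loc g -> Linfty_loc (fun r => g (r + a)).
Proof.
move=> a0 [[s [ss sg]] gb]; split.
  exists (fun n => s n \o +%R^~ a).
  split; first by move=> n; exact: simple_shift.
  apply: negligibleS (negligible_shift a sg) => r /= nP h; apply: nP.
  by rewrite in_itv/= andbT => r0; apply: h; rewrite in_itv/= andbT addr_ge0.
move=> t t0; have [|M M0 hM] := Linfty_norm_bound (gb (t + a) _).
  exact: addr_ge0.
apply: (@le_lt_trans _ _ M%:E); last exact: ltry.
apply: Linfty_norm_le => //.
apply: negligibleS (negligible_shift a hM) => r /= nP h; apply: nP.
rewrite in_itv/= => /andP[r0 rt]; apply: h.
by rewrite in_itv/= lerD2r addr_ge0.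
Qed.

End EssentialBounds.

(** * Local boundedness and left continuity of a C_0-semigroup *)

Section SemigroupContinuity.
Context {R : realType} (X : completeNormedModType R).
Variables (T : R -> X -> X) (hT : C0_semigroup T).

(** Otherwise there are times [h n <= 1 / (n + 1)] at which the operator norm exceeds [n]. As
    [T (h n) x] tends to [x] for each [x], this contradicts the uniform boundedness principle. *)
Lemma C0_semigroup_bounded_near0 : exists2 d : R, 0 < d &
  exists2 M : R, 0 <= M & forall h x, 0 <= h <= d -> `|T h x| <= M * `|x|.
Proof.
have [lc T0 TD Tc] := hT.
apply/not_exists2P => hn.
have /choice[h hh] : forall n : nat, exists h : R, 0 <= h <= n.+1%:R^-1 /\
    exists x, n%:R * `|x| < `|T h x|.
  move=> n; have [nP|hd] := hn n.+1%:R^-1.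
    by exfalso; apply: nP; rewrite invr_gt0.
  apply: contrapT => hN; apply: hd; exists n%:R => // h x hd.
  rewrite leNgt; apply/negP => lt; apply: hN.
  by exists h; split => //; exists x.
have h0 n : 0 <= h n by case: (hh n) => /andP[].
have : uniform_bounded (range (fun n => T (h n))).
  apply: Banach_Steinhauss.
    move=> _ [n _ <-]; have [lT cT] := lc _ (h0 n); split => //.
    have [C C0 hC] := linear_continuous_bound lT cT.
    move=> r; exists (C * r) => x xr; apply: le_trans (hC x) _.
    by rewrite ler_pM2l.
  move=> x.
  have : T (h n) x @[n --> \oo] --> x.
    apply/cvgrPdist_lt => e e0.
    have /cvgrPdist_lt/(_ _ e0) := Tc x.
    rewrite near_withinE => /nbhs_ballP[d /= d0 hd].
    (* The limit at 0 runs over positive times only, so [h n = 0] is treated apart. *)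
    near=> n; have [->|hn0] := eqVneq (h n) 0; first by rewrite T0 subrr normr0.
    apply: hd => /=; last by rewrite lt_neqAle eq_sym hn0 h0.
    rewrite /ball/= sub0r normrN ger0_norm//.
    have [/andP[_ hle] _] := hh n; apply: (le_lt_trans hle).
    near: n; exact: near_infty_natSinv_lt (PosNum d0).
  move=> cv; have /cvg_seq_bounded : cvgn (fun n => T (h n) x).
    by apply/cvg_ex; exists x.
  move=> [M [_ hM]]; exists (M + 1) => _ [n _ <-].
  by apply: hM => //; rewrite ltrDl.
move=> /(_ 1)[M hM].
have [n Mn] : exists n : nat, M < n%:R.
  by exists (Num.truncn M).+1; exact: truncnS_gt.
have [_ [x nx]] := hh n.
have [lT _] := lc _ (h0 n).
pose L := pack_linear lT.
have x0 : 0 < `|x|.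
  rewrite lt_neqAle normr_ge0 andbT eq_sym normr_eq0; apply/eqP => x0.
  by move: nx; rewrite x0 -[T (h n)]/(L : _ -> _) linear0 normr0 mulr0 ltxx.
(* The bound [M] on the unit ball, tested on [x] divided by its norm, contradicts the choice
   [M < n]. *)
have := hM _ (ex_intro2 _ _ n I erefl) (`|x|^-1 *: x).
rewrite -[T (h n)]/(L : _ -> _) linearZ normrZ normfV normr_id.
rewrite normrZ normfV normr_id mulVf ?gt_eqF// => /(_ (lexx 1)).
rewrite mulrC ler_pdivrMr// => le.
have := lt_le_trans nx le; rewrite ltr_pM2r// => /ltW.
by rewrite leNgt Mn.
Unshelve. all: by end_near. Qed.

(** For [s < t] the difference is [T s (T (t - s) x - x)], and [T s] is bounded uniformly for [s]
    near [t]. *)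
Lemma C0_semigroup_left_continuous (t : R) (x : X) :
  0 < t -> T s x @[s --> t^'-] --> T t x.
Proof.
move=> t0; have [lc T0 TD Tc] := hT.
have [d d0 [M M0 hM]] := C0_semigroup_bounded_near0.
pose e := Num.min d t.
have e0 : 0 < e by rewrite lt_min d0.
have et : e <= t by rewrite ge_min lexx orbT.
have ed : e <= d by rewrite ge_min lexx.
have te0 : 0 <= t - e by rewrite subr_ge0.
have [lT cT] := lc _ te0.
have [C C0 hC] := linear_continuous_bound lT cT.
(* Here [T s] factors as [T (t - e)] after [T (s - (t - e))], the latter at a time at most [d]. *)
have bnd s y : t - e <= s <= t -> `|T s y| <= C * (M * `|y|).
  move=> /andP[es st]; rewrite -[s](subrKC (t - e)) TD ?subr_ge0//.
  apply: le_trans (hC _) _; rewrite ler_pM2l//; apply: hM.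
  rewrite subr_ge0 es/=; apply: le_trans ed.
  by rewrite lerBlDl subrK.
apply/cvgrPdist_lt => eps eps0.
(* The summand 1 keeps [K] positive when [M = 0]. *)
pose K := C * M + 1; have K0 : 0 < K by rewrite ltr_wpDl// mulr_ge0// ltW.
have /cvgrPdist_lt/(_ (eps / K)) := Tc x.
rewrite divr_gt0// => /(_ isT); rewrite near_withinE => /nbhs_ballP[r /= r0 hr].
near=> s.
have st : s < t by near: s; exact: nbhs_left_lt.
have es : t - e < s by near: s; apply: nbhs_left_gt; rewrite ltrBlDr ltrDl.
have rs : t - r < s by near: s; apply: nbhs_left_gt; rewrite ltrBlDr ltrDl.
have s0 : 0 <= s by rewrite (le_trans te0)// ltW.
have [ls _] := lc _ s0.
pose L := pack_linear ls.
rewrite -{1}[t](subrKC s) TD ?subr_ge0 ?(ltW st)//.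
rewrite -[T s]/(L : _ -> _) -linearB.
apply: le_lt_trans (bnd s _ _) _; first by rewrite !ltW.
have : `|x - T (t - s) x| < eps / K.
  apply: hr => /=; last by rewrite subr_gt0.
  by rewrite /ball/= sub0r normrN gtr0_norm ?subr_gt0// ltrBlDl -ltrBlDr.
rewrite ltr_pdivlMr// distrC mulrA => h.
apply: le_lt_trans h; rewrite mulrC ler_wpM2l// /K lerDl//.
Unshelve. all: by end_near. Qed.

End SemigroupContinuity.

(** * Trajectories, the nonlinearity and the embedding into the extrapolation space *)

Section Preliminaries.
Context {R : realType}.
Notation mu := (@lebesgue_measure R).

Lemma within_continuous_distP (X : normedModType R) (D : set R) (x : R -> X) :
  {within D, continuous x} <->
  forall s, D s -> forall e, 0 < e -> exists2 d, 0 < d &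
    forall r, D r -> `|s - r| < d -> `|x s - x r| < e.
Proof.
split.
  move=> /subspace_continuousP cx s Ds e e0.
  have /cvgrPdist_lt/(_ _ e0) := cx s Ds.
  rewrite near_withinE => /nbhs_ballP[d d0 hd]; exists d => // r Dr sr.
  exact: hd.
move=> h; apply/subspace_continuousP => s Ds; apply/cvgrPdist_lt => e e0.
have [d d0 hd] := h s Ds e e0.
rewrite near_withinE; apply/nbhs_ballP; exists d => // r sr Dr.
exact: hd.
Qed.

Lemma cvg_at_left_distP (X : normedModType R) (m : R) (x : R -> X) (l : X) :
  x t @[t --> m^'-] --> l <->
  forall e, 0 < e -> exists2 d, 0 < d &
    forall t, m - d < t < m -> `|l - x t| < e.
Proof.
split.
  move=> xl e e0; have /cvgrPdist_lt/(_ _ e0) := xl.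
  rewrite near_withinE => /nbhs_ballP[d d0 hd]; exists d => // t /andP[dt tm].
  by apply: hd => //; rewrite /ball/= gtr0_norm ?subr_gt0// ltrBlDl -ltrBlDr.
move=> h; apply/cvgrPdist_lt => e e0; have [d d0 hd] := h e e0.
near=> t; apply: hd; apply/andP; split; near: t; last exact: nbhs_left_lt.
by apply: nbhs_left_gt; rewrite ltrBlDr ltrDl.
Unshelve. all: by end_near. Qed.

(** Condition (b) concerns functions continuous on all of R_+; stopping provides such functions.
    Continuity persists because [Num.min ^~ tau] does not increase distances. *)
Lemma continuous_stopped (X : normedModType R) (tau : R) (x : R -> X) :
  0 <= tau -> {within `[0, tau], continuous x} ->
  {within `[0, +oo[, continuous (fun s => x (Num.min s tau))}.
Proof.
move=> tau0 /within_continuous_distP cx; apply/within_continuous_distP => s.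
have inI r : 0 <= r -> `[0, tau]%classic (Num.min r tau).
  by move=> r0; rewrite /= in_itv/= le_min r0 tau0/= ge_min lexx orbT.
rewrite /= in_itv/= andbT => s0 e e0.
have [d d0 hd] := cx _ (inI s s0) e e0; exists d => // r.
rewrite /= in_itv/= andbT => r0 sr; apply: hd; first exact: inI.
apply: le_lt_trans sr.
case: (leP s tau) => st; case: (leP r tau) => rt //.
- rewrite !ler0_norm ?subr_le0 ?(ltW rt)//; last exact: le_trans (ltW rt).
  by rewrite lerN2 lerD2l lerN2 ltW.
- rewrite !ger0_norm ?subr_ge0//; last exact: le_trans (ltW st).
  by rewrite lerD2r ltW.
by rewrite subrr normr0.
Qed.

(** The upper limit is an infimum of suprema over the sets of the filter; if it is not [+oo], one of
    these suprema is finite. *)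
Lemma limf_esup_norm_left_bounded (X : normedModType R) (m : R) (x : R -> X) :
  limf_esup (fun t => (`|x t|)%:E) m^'- <> +oo%E ->
  exists2 K, 0 <= K &
    exists2 d, 0 < d & forall t, m - d < t < m -> `|x t| <= K.
Proof.
move=> /eqP; rewrite -ltey => /ereal_inf_lt[_ [A Am <-]] supA.
have [d d0 hd] : exists2 d, 0 < d & forall t, m - d < t < m -> A t.
  move: Am; rewrite /at_left /within /= => /nbhs_ballP[d d0 hd].
  exists d => // t /andP[dt tm].
  by apply: hd => //; rewrite /ball/= gtr0_norm ?subr_gt0// ltrBlDl -ltrBlDr.
exists `|fine (ereal_sup [set (`|x t|)%:E | t in A])| => //.
exists d => // t tI.
have := ereal_sup_ubound (ex_intro2 _ _ t (hd t tI) erefl :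
  [set (`|x t|)%:E | t in A] _).
case: (ereal_sup _) supA => [r| |]//= _; rewrite lee_fin => /le_trans; apply.
exact: ler_norm.
Qed.

(** The Lipschitz condition bounds [f y v - f 0 v], and the growth condition with monotone [sigma]
    bounds [f 0 v]. *)
Lemma superposition_bounded (X U V : normedModType R) (f : X -> U -> V)
    (sigma : R -> R) (c C : R) : Lipschitz_on_bounded f -> Kinfty sigma ->
  (forall u : U, `|f 0 u| <= sigma `|u| + c) -> 0 <= C ->
  exists2 M, 0 <= M & forall y v, `|y| <= C -> `|v| <= C -> `|f y v| <= M.
Proof.
move=> fLip [_ sinc _ _] fc C0.
have C1 : C < C + 1 by rewrite ltrDl.
(* The Lipschitz condition is on open balls, so the radius [C + 1] is used to include the closed
   ball of radius [C]. *)
have [|L L0 hL] := fLip (C + 1); first exact: le_lt_trans C1.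
exists `|L * C + (sigma C + c)| => // y v yC vC.
apply: le_trans (ler_norm _).
rewrite -[f y v](subrK (f 0 v)); apply: le_trans (ler_normD _ _) _.
apply: lerD.
  apply: (le_trans (hL 0 y v _ _ _)); rewrite ?normr0 ?(le_lt_trans _ C1)//.
  by rewrite subr0 ler_pM2l.
apply: le_trans (fc v) _; rewrite lerD2r.
by move: vC; rewrite le_eqVlt => /predU1P[->//|vC]; apply/ltW/sinc.
Qed.

Lemma extrapolation_embedding_injective (X : normedModType R) (DA : set X)
    (A : X -> X) (T : R -> X -> X) (Xm1 : completeNormedModType R)
    (j : X -> Xm1) :
  generates DA A T -> is_extrapolation_space DA A j -> linear j /\ injective j.
Proof.
move=> [[lc _ _ _] gen] [a [Ra [[lR _ hR _] lj jR _]]]; split => //.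
(* If [Ra z = 0] then [z = - A 0]. The value [A 0] is read off as the limit of the difference
   quotients at 0, all of which vanish. *)
have Ra_inj z : Ra z = 0 -> z = 0.
  move=> Rz; have [D0 <-] := hR z; rewrite Rz scaler0 sub0r.
  have /gen h : DA 0 /\ A 0 = A 0 by split => //; move: D0; rewrite Rz.
  suff -> : A 0 = 0 by rewrite oppr0.
  apply: (norm_cvg_unique h).
  rewrite /=; apply/cvgrPdist_lt => e e0; near=> r.
  have [lT _] : linear (T r) /\ continuous (T r).
    by apply: lc; near: r; exact: nbhs_right_ge.
  by rewrite (linear_zero lT) subrr scaler0 subrr normr0.
move=> y z jyz; apply/eqP; rewrite -subr_eq0; apply/eqP/Ra_inj/eqP.
by rewrite -normr_eq0 -jR linear_sub// jyz subrr normr0.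
Unshelve. all: by end_near. Qed.

(** The splitting of the convolution is an identity in [Xm1]. As [j] is injective, linear and
    intertwines the semigroups, it descends to [X], where admissibility bounds the convolution with
    the shifted input. *)
Lemma convolution_increment (X Xm1 V : normedModType R) (j : X -> Xm1)
    (T : R -> X -> X) (Tm1 : R -> Xm1 -> Xm1) (B : V -> Xm1) (a t h M : R)
    (w : R -> V) (ya yt : X) :
  linear j -> injective j -> is_extrapolated_semigroup j T Tm1 ->
  0 <= a -> a <= t -> 0 <= h -> 0 <= M -> Linfty_loc w ->
  (forall w', Linfty_loc w' -> exists x : X,
     is_convolution Tm1 B (t - a) w' (j x) /\
     ((`|x|)%:E <= h%:E * Linfty_norm `[0%R, (t - a)%R] w')%E) ->
  is_convolution Tm1 B a w (j ya) -> is_convolution Tm1 B t w (j yt) ->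
  {ae mu, forall r, a <= r <= t -> `|w r| <= M} ->
  `|yt - T (t - a) ya| <= h * M.
Proof.
move=> lj ij [Tm1C Tm1T] a0 at0 h0 M0 wl adm cya cyt wM.
have [z [cz zh]] := adm _ (Linfty_loc_shift a0 wl).
have jyt := convolution_split Tm1C a0 at0 cya cz cyt.
rewrite Tm1T ?subr_ge0// -linear_add// in jyt.
rewrite (ij _ _ jyt) addrC addKr -lee_fin EFinM; apply: (le_trans zh).
apply: lee_wpmul2l; first by rewrite lee_fin.
apply: Linfty_norm_le => //.
apply: negligibleS (negligible_shift a wM) => r /= nP hr; apply: nP.
rewrite in_itv/= => /andP[r0 rt]; apply: hr.
by rewrite lerDr r0 -lerBrDr.
Qed.

End Preliminaries.

(** Keeps points near [s < m] inside [[0, (s + m) / 2]], where the mild solution is available. *)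
Lemma le_midf_dist (R : realFieldType) (s m t : R) :
  `|s - t| < (m - s) / 2 -> t <= (s + m) / 2.
Proof. by rewrite ltr_norml => /andP[h _]; lra. Qed.

Lemma thirds (R : realFieldType) (e : R) : e / 3 + (e / 3 + e / 3) = e.
Proof. by lra. Qed.

(** * Continuation of a bounded trajectory up to and including its final time *)

Theorem proposition3p19 (R : realType) (X U V : completeNormedModType R)
  (DA : set X) (A : X -> X) (T : R -> X -> X) (hA : generates DA A T)
  (Xm1 : completeNormedModType R) (j : X -> Xm1)
  (hXm1 : is_extrapolation_space DA A j)
  (Tm1 : R -> Xm1 -> Xm1) (hTm1 : is_extrapolated_semigroup j T Tm1)
  (B : {linear U -> Xm1}) (hB : continuous B)
  (B2 : {linear V -> Xm1}) (hB2 : continuous B2)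
  (f : X -> U -> V)
  (* (a) *)
  (hBadm : infty_admissible j Tm1 B)
  (hPhi : input_map_continuous j Tm1 B)
  (* (b) *)
  (hB2adm : zero_class_infty_admissible j Tm1 B2)
  (hfLinfty : superposition_Linfty_loc f)
  (* (c) *)
  (hfLip : Lipschitz_on_bounded f)
  (hfcont : forall x : X, continuous (f x))
  (hfgrowth : exists (sigma : R -> R) (c : R),
     [/\ Kinfty sigma, 0 < c &
         forall u : U, `|f 0 u| <= sigma `|u| + c])
  (tm : X -> (R -> U) -> \bar R) (phi : R -> X -> (R -> U) -> X)
  (hphi : is_flow j T Tm1 B B2 f tm phi) :
  BIC tm phi.
Proof.
move=> x0 u uL tmfin; apply: contrapT => bnd.
have [tm0 sol nomax] := hphi x0 u uL.
case Em : (tm x0 u) tm0 tmfin => [m| |]// tm0 _.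
rewrite Em /= in sol nomax bnd.
have {tm0} m0 : 0 < m by rewrite -lte_fin.
have {bnd} [K K0 [d d0 xK]] := limf_esup_norm_left_bounded bnd.
set x := (fun t => phi t x0 u) in sol nomax xK.
have [lj ij] := extrapolation_embedding_injective hA hXm1.
have [Tm1C Tm1T] := hTm1.
have [TC _] := hA.
have [Phi [PhiC Phic]] := hPhi.
have [hh [hh0 hhmono hhadm hhlim]] := hB2adm.
have [sigma [c [sigmaK c0 fgrowth]]] := hfgrowth.
have [Cu Cu0 uCu] : exists2 Cu, 0 <= Cu &
    {ae lebesgue_measure, forall r, 0 <= r -> `|u r| <= Cu}.
  have [_ /Linfty_norm_bound[Cu Cu0 hu]] := uL; exists Cu => //.
  apply: negligibleS hu => r /= nP hr; apply: nP => r0.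
  by apply: hr; rewrite in_itv/= r0.
(* Defined by subtraction, the contribution of [f] takes values in [X]; its image under [j] is then
   shown to be the convolution. *)
pose Psi t := x t - T t x0 - Phi t u.
have PsiC t : 0 <= t -> t < m ->
    is_convolution Tm1 B2 t (fun s => f (x s) (u s)) (j (Psi t)).
  (* The midpoint of [t] and [m] is a positive time below [m], also for [t = 0], so the solution is
     available up to it. *)
  move=> t0 tm'; have tau0 : 0 < (t + m) / 2.
    by rewrite divr_gt0// ltr_wpDl.
  have [|_ solt] := sol _ tau0; first by rewrite lte_fin midf_lt.
  have [|y1 [y2 [c1 c2 jx]]] := solt t; first by rewrite t0 midf_le// ltW.
  rewrite /Psi !(linear_sub _ _ lj) jx.
  rewrite (convolution_unique (fun _ _ => erefl) (PhiC t u t0 uL) c2).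
  by rewrite addrAC addrK [_ + y1]addrC addrK.
pose a0 := Num.max 0 (m - d).
have a00 : 0 <= a0 by rewrite le_max lexx.
have a0m : a0 < m by rewrite gt_max m0 ltrBlDr ltrDl.
(* After [a0] the trajectory is bounded by [K], and [a0] is nonnegative. *)
have xK' r : a0 < r -> r < m -> `|x r| <= K.
  by rewrite gt_max => /andP[_ dr] rm; apply: xK; rewrite dr.
(* [z] is [x] stopped at [t], or [x] extended by its limit when [t = m]. *)
have incr C (t : R) (yt : X) (z : R -> X) a : K <= C ->
    {within `[0, +oo[, continuous z} -> a0 < a -> a < t -> t <= m ->
    (forall s, 0 <= s -> s < t -> z s = x s) -> `|z t| <= C ->
    is_convolution Tm1 B2 t (fun s => f (z s) (u s)) (j yt) ->
    forall M, (forall y v, `|y| <= Num.max C Cu -> `|v| <= Num.max C Cu ->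
      `|f y v| <= M) ->
    `|yt - T (t - a) (Psi a)| <= hh (t - a) * M.
  move=> KC zc a0a at' tm' zx ztC cyt M hM.
  have a_ge0 : 0 <= a by rewrite (le_trans a00)// ltW.
  have ta0 : 0 < t - a by rewrite subr_gt0.
  have wl : Linfty_loc (fun s => f (z s) (u s)) by exact: hfLinfty.
  have M0 : 0 <= M
    by apply: le_trans (hM 0 0 _ _) => //; rewrite normr0 le_max Cu0 orbT.
  have ca : is_convolution Tm1 B2 a (fun s => f (z s) (u s)) (j (Psi a)).
    apply: eq_convolution (PsiC a _ _) => //.
      by move=> s /andP[s0 sa]; rewrite zx// (le_lt_trans sa).
    exact: lt_le_trans tm'.
  apply: (convolution_increment lj ij hTm1 a_ge0 (ltW at') (ltW (hh0 _ ta0))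
    M0 wl _ ca cyt).
    by move=> w' w'l; exact: hhadm.
  apply: negligibleS uCu => r /= nP ur; apply: nP => /andP[ar rt].
  have r0 : 0 <= r by exact: le_trans ar.
  apply: hM; last by rewrite le_max ur// orbT.
  rewrite le_max; apply/orP; left.
  move: rt; rewrite le_eqVlt => /predU1P[->//|rt].
  by rewrite zx// (le_trans _ KC)// xK'// ?(lt_le_trans a0a)// (lt_le_trans rt).
have xc t : 0 < t -> t < m ->
    {within `[0, +oo[, continuous (fun s => x (Num.min s t))}.
  move=> t0 tm'; apply: continuous_stopped; first exact: ltW.
  by have [|] := sol t t0.
have incrx C a t : K <= C -> a0 < a -> a < t -> t < m ->
    forall M, (forall y v, `|y| <= Num.max C Cu -> `|v| <= Num.max C Cu ->
      `|f y v| <= M) ->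
    `|Psi t - T (t - a) (Psi a)| <= hh (t - a) * M.
  move=> KC a0a at' tm'.
  have t0 : 0 < t by rewrite (le_lt_trans a00)// (lt_trans a0a).
  apply: (incr C t _ (fun s => x (Num.min s t))) => //.
  - exact: xc.
  - exact: ltW.
  - by move=> s s0 st; rewrite min_l// ltW.
  - by rewrite minxx (le_trans _ KC)// xK'// (lt_trans a0a).
  apply: eq_convolution (PsiC t (ltW t0) tm') => s /andP[s0 st].
  by rewrite min_l.
(* The time [a] is so close to [m] that the increment after [a] is below [e]; with [a] fixed, left
   continuity of the semigroup at [m - a] then gives [r]. *)
have center M e : 0 <= M -> 0 < e -> exists a, [/\ a0 < a, a < m,
    hh (m - a) * M < e & exists2 r, 0 < r & forall t, m - r < t < m ->
      a < t /\ `|T (m - a) (Psi a) - T (t - a) (Psi a)| < e].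
  move=> M0 e0.
  have M1 : 0 < M + 1 by rewrite ltr_wpDl.
  have [r r0 hr] : exists2 r, 0 < r & forall s, 0 < s < r -> hh s < e / (M + 1).
    have /cvgrPdist_lt/(_ (e / (M + 1))) := hhlim.
    rewrite divr_gt0// => /(_ isT).
    rewrite near_withinE => /nbhs_ballP[r /= r0 hr]; exists r => //.
    move=> s /andP[s0 sr].
    apply: le_lt_trans (ler_norm _) _; rewrite -normrN -sub0r; apply: hr => //.
    by rewrite /ball/= sub0r normrN gtr0_norm.
  (* This is the distance from [a] to [m]: less than [r] for the smallness of [hh], less than
     [m - a0] for [a0 < a]. *)
  pose q := Num.min r (m - a0) / 2.
  have q0 : 0 < q by rewrite divr_gt0// lt_min r0 subr_gt0.
  have q2 : q < Num.min r (m - a0).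
    by rewrite ltr_pdivrMr// mulr2n mulrDr mulr1 ltrDl lt_min r0 subr_gt0.
  move: q2; rewrite lt_min => /andP[qr qm].
  exists (m - q); rewrite subKr; split.
  - by rewrite ltrBrDr -ltrBrDl.
  - by rewrite ltrBlDr ltrDl.
  - have := hr q; rewrite q0 qr ltr_pdivlMr// => /(_ isT) h.
    by apply: le_lt_trans h; rewrite ler_pM2l ?lerDl// hh0.
  have /cvg_at_left_distP/(_ e e0)[p p0 hp] :=
    C0_semigroup_left_continuous TC (x := Psi (m - q)) q0.
  exists (Num.min p q); first by rewrite lt_min p0.
  move=> t; rewrite ltrBlDr -ltrBlDl lt_min => /andP[/andP[tp tq] tm'].
  split; first by rewrite ltrBlDr -ltrBlDl.
  apply: hp; rewrite opprB addrCA; apply/andP; split.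
    by rewrite ltrD2l ltrNl opprB.
  by rewrite gtrDl subr_lt0.
have max0 C : 0 <= Num.max C Cu by rewrite le_max Cu0 orbT.
(* Since [hh] is nondecreasing, the bound at [m - a] serves every [t] in []a, m]]. *)
have center_le M e a t yt : 0 <= M -> a0 < a -> a < t -> t <= m ->
    hh (m - a) * M < e ->
    `|yt - T (t - a) (Psi a)| <= hh (t - a) * M ->
    `|yt - T (t - a) (Psi a)| < e.
  move=> M0 a0a at' tm' hM /le_lt_trans; apply; apply: le_lt_trans hM.
  by rewrite ler_wpM2r// hhmono ?subr_gt0// lerD2r.
have cvPsi : cvg (Psi t @[t --> m^'-]).
  have [M M0 hM] := superposition_bounded hfLip sigmaK fgrowth (max0 K).
  apply/cauchy_cvgP; apply: cauchy_exP => e e0.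
  have e20 : 0 < e / 2 by rewrite divr_gt0.
  have [a [a0a am hae [r r0 hr]]] := center M (e / 2) M0 e20.
  (* By completeness it suffices to find, for each [e], a ball of radius [e] that contains [Psi t]
     for [t] near [m]; this is its centre. *)
  exists (T (m - a) (Psi a)).
  suff : \forall t \near m^'-, ball (T (m - a) (Psi a)) e (Psi t) by [].
  near=> t.
  have tm' : t < m by near: t; exact: nbhs_left_lt.
  have [|at' h] := hr t.
    by rewrite tm' andbT; near: t; apply: nbhs_left_gt; rewrite ltrBlDr ltrDl.
  have h2 := center_le M _ a t _ M0 a0a at' (ltW tm') hae
    (incrx K a t (lexx K) a0a at' tm' M hM).
  rewrite /= -ball_normE /= [e]splitr.
  rewrite -(subrK (T (t - a) (Psi a)) (T (m - a) (Psi a))) -addrA.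
  apply: le_lt_trans (ler_normD _ _) _; apply: ltrD => //.
  by rewrite distrC.
pose xs := T m x0 + lim (Psi t @[t --> m^'-]) + Phi m u.
have xxs : x t @[t --> m^'-] --> xs.
  rewrite (_ : x = fun t => T t x0 + Psi t + Phi t u); last first.
    by apply/funext => t; rewrite /Psi [T t x0 + _]addrC addrAC !subrK.
  apply: cvgD; first by apply: cvgD => //; exact: C0_semigroup_left_continuous.
  apply/cvg_at_left_distP => e e0.
  (* Joint continuity of the input map is used with the input [u] kept fixed, at distance 0 from
     itself. *)
  have [r r0 hr] := Phic m u (ltW m0) uL e e0.
  exists (Num.min r m); first by rewrite lt_min r0.
  move=> t; rewrite ltrBlDr -ltrBlDl lt_min => /andP[/andP[tr tm1] tm2].
  rewrite distrC; apply: hr => //.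
  - by move: tm1; rewrite gtrBl => /ltW.
  - by rewrite ltr0_norm ?subr_lt0// opprB.
  apply: (@le_lt_trans _ _ 0%:E); last by rewrite lte_fin.
  apply: Linfty_norm_le => //; apply: nearW => r'.
  by rewrite /= subrr normr0.
pose y s := if s < m then x s else xs.
have yx s : s < m -> y s = x s by rewrite /y => ->.
have ym : y m = xs by rewrite /y ltxx.
have yc : {within `[0, m], continuous y}.
  apply/within_continuous_distP => s; rewrite /= in_itv/= => /andP[s0].
  rewrite le_eqVlt => /predU1P[->|sm] e e0.
    have /cvg_at_left_distP/(_ e e0)[r r0 hr] := xxs.
    exists r => // t; rewrite /= in_itv/= => /andP[t0].
    rewrite le_eqVlt => /predU1P[->|tm']; first by move=> _; rewrite subrr normr0.
    rewrite gtr0_norm ?subr_gt0// ltrBlDl -ltrBlDr => mr.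
    by rewrite ym yx//; apply: hr; rewrite mr.
  have tau0 : 0 < (s + m) / 2 by rewrite divr_gt0// ltr_wpDl.
  have [|xcs _] := sol _ tau0; first by rewrite lte_fin midf_lt.
  move/within_continuous_distP in xcs.
  have [|r r0 hr] := xcs s _ e e0; first by rewrite /= in_itv/= s0 midf_le// ltW.
  exists (Num.min r ((m - s) / 2)); first by rewrite lt_min r0 divr_gt0// subr_gt0.
  move=> t; rewrite /= in_itv/= lt_min => /andP[t0 _] /andP[st1 st2].
  have tI : t <= (s + m) / 2 by exact: le_midf_dist st2.
  rewrite !yx//; last by apply: le_lt_trans tI _; rewrite midf_lt.
  by apply: hr => //; rewrite /= in_itv/= t0.
(* Stopping [y] at [m] gives a function to which (b) applies, so that the convolution at time [m]
   exists and lies in [X]. *)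
pose z s := y (Num.min s m).
have zc : {within `[0, +oo[, continuous z} by apply: continuous_stopped => //; exact: ltW.
have zy s : s <= m -> z s = y s by move=> sm; rewrite /z min_l.
have [Pm [PmC _]] := hhadm m _ m0 (hfLinfty z u zc uL).
have PsiPm : Psi t @[t --> m^'-] --> Pm.
  (* The bound must also cover [z m = xs]. *)
  pose C := Num.max K `|xs|.
  have [M M0 hM] := superposition_bounded hfLip sigmaK fgrowth (max0 C).
  have KC : K <= C by rewrite le_max lexx.
  apply/cvgrPdist_lt => e e0.
  have e30 : 0 < e / 3 by rewrite divr_gt0.
  have [a [a0a am hae [r r0 hr]]] := center M (e / 3) M0 e30.
  near=> t.
  have tm' : t < m by near: t; exact: nbhs_left_lt.
  have [|at' h] := hr t.
    by rewrite tm' andbT; near: t; apply: nbhs_left_gt; rewrite ltrBlDr ltrDl.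
  have h1 := center_le M _ a t _ M0 a0a at' (ltW tm') hae
    (incrx C a t KC a0a at' tm' M hM).
  have h2 : `|Pm - T (m - a) (Psi a)| < e / 3.
    apply: (center_le M _ a m) => //.
    apply: (incr C m Pm z a) => //.
      by move=> s s0 sm; rewrite zy ?yx// ltW.
    by rewrite zy// ym le_max lexx orbT.
  have -> : Pm - Psi t = (Pm - T (m - a) (Psi a)) +
      ((T (m - a) (Psi a) - T (t - a) (Psi a)) + (T (t - a) (Psi a) - Psi t)).
    by rewrite !addrA !subrK.
  apply: le_lt_trans (ler_normD _ _) _.
  apply: (@lt_le_trans _ _ (e / 3 + (e / 3 + e / 3))); last by rewrite thirds.
  apply: ltrD => //; apply: le_lt_trans (ler_normD _ _) _; apply: ltrD => //.
  by rewrite distrC.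
(* By uniqueness of limits, the left limit of [Psi] is the convolution at time [m]. *)
have xsE : xs = T m x0 + Pm + Phi m u.
  by rewrite /xs (norm_cvg_unique cvPsi PsiPm).
(* The extension [y] solves on the closed interval [[0, m]]: at [t = m] by the identity for [xs],
   before [m] because it coincides there with [x]. *)
apply: nomax; exists m, y; split => //; first by move=> t t0; rewrite lte_fin => /yx.
split => // t /andP[t0]; rewrite le_eqVlt => /predU1P[->|tm'].
  exists (j Pm), (j (Phi m u)); split.
  - by apply: eq_convolution PmC => s /andP[_ /zy ->].
  - by apply: PhiC => //; exact: ltW.
  by rewrite ym xsE !(linear_add _ _ lj).
have tau0 : 0 < (t + m) / 2 by rewrite divr_gt0// ltr_wpDl.
have [|_ solt] := sol _ tau0; first by rewrite lte_fin midf_lt.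
have [|y1 [y2 [c1 c2 jx]]] := solt t; first by rewrite t0 midf_le// ltW.
exists y1, y2; split => //; last by rewrite yx.
apply: eq_convolution c1 => s /andP[_ st]; rewrite yx//.
exact: le_lt_trans tm'.
Unshelve. all: by end_near. Qed.
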